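(* Let $\mu$ be a symmetric, finite Borel measure on $[0,1]$ and let $(m_0,m_1,m_2,\dots)$ be the monic Legendre polynomials associated to $\mu$. Then $m_0(x)=1$, $m_1(x)=x-\tfrac12$, and $m_n$ alternates parity with respect to the line $x=\tfrac12$. Moreover, for all nonnegative integers $n$, $$m_{n+2}(x)=\left(x-\frac12\right)m_{n+1}(x)-\frac{\|m_{n+1}\|_\mu^2}{\|m_n\|_\mu^2}\,m_n(x).$$
   Context: A Borel measure $\mu$ supported in $[0,1]$ is called symmetric if $\mu(E)=\mu(1-E)$ for every Borel-measurable set $E$, where $1-E=\{1-x : x\in E\}$. A sequence $(p_0,p_1,\dots)$ is a sequence of Legendre polynomials associated to $\mu$ if each $p_k$ is a polynomial of degree $k$ and, for all $k\ne\ell$, $p_k$ and $p_\ell$ are orthogonal elements of $L^2_\mu[0,1]$; the family is regarded as determined uniquely by $\mu$ up to scaling each polynomial, and the monic Legendre polynomials are the ones with leading coefficient $1$. Here $\|p\|_\mu$ denotes the norm in $L^2_\mu[0,1]$, i.e. $\|p\|_\mu^2=\int_0^1 |p(x)|^2\,d\mu(x)$. That $m_n$ alternates parity with respect to the line $x=\tfrac12$ means that the parity of $m_n$ about $x=\tfrac12$ matches the parity of $n$: $m_n(1-x)=(-1)^n m_n(x)$ for all $n\ge 0$.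
   Formalization: The measure is additionally assumed not to be concentrated on a finite set; otherwise (e.g. a point mass at 1/2) the monic Legendre polynomials are not uniquely determined and some norm in the denominator of the recurrence is zero. *)

(* Defs.v *)
From HB Require Import structures.
From mathcomp Require Import all_boot all_order all_algebra.
From mathcomp Require Import all_classical all_reals all_analysis.

Set Implicit Arguments.
Unset Strict Implicit.
Unset Printing Implicit Defensive.

Import Order.TTheory GRing.Theory Num.Theory.
Import numFieldNormedType.Exports.

Local Open Scope classical_set_scope.
Local Open Scope ring_scope.

(* [measurableTypeR R] is R with its Borel sigma-algebra. *)
Notation borel_measure R := {finite_measure set (measurableTypeR R) -> \bar R}.

Definition supported_in01 (R : realType) (mu : borel_measure R) : Prop :=
  mu (~` `[0, 1]) = 0%E.

Definition symmetric_measure (R : realType) (mu : borel_measure R) : Prop :=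
  forall E : set (measurableTypeR R),
    measurable E -> mu E = mu [set 1 - x | x in E].

(* Orthogonal polynomials of every degree are determined by mu up to scaling
   exactly when mu is not concentrated on finitely many points; otherwise all
   polynomials vanishing at those points are null in L^2(mu). *)
Definition infinitely_supported (R : realType) (mu : borel_measure R) : Prop :=
  forall A : set (measurableTypeR R), finite_set A -> mu (~` A) != 0%E.

Definition inner_mu (R : realType) (mu : borel_measure R) (p q : {poly R}) : R :=
  \int[mu]_(x in `[0, 1]) (p.[x] * q.[x]).

Definition norm_mu (R : realType) (mu : borel_measure R) (p : {poly R}) : R :=
  Num.sqrt (\int[mu]_(x in `[0, 1]) (`|p.[x]| ^+ 2)).

(* [size p] is the degree of p plus one. *)
Definition legendre_sequence (R : realType) (mu : borel_measure R)
    (p : nat -> {poly R}) : Prop :=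
  (forall k, size (p k) = k.+1) /\
  (forall k l, k <> l -> inner_mu mu (p k) (p l) = 0).

Definition monic_legendre_sequence (R : realType) (mu : borel_measure R)
    (m : nat -> {poly R}) : Prop :=
  legendre_sequence mu m /\ (forall k, m k \is monic).

(* Main.v *)
(** The form (p, q) |-> L (p * q), with L the integral against mu, is positive
    definite because mu charges no finite set of roots fully, and the symmetry of
    mu makes L invariant under x |-> 1 - x. A polynomial of degree less than n
    orthogonal to m_0, ..., m_(n-1) is therefore zero. Applied to
    m_n (1 - x) - (-1)^n m_n x this gives parity; applied to the difference of
    the two sides of the recurrence at degree n + 2 it leaves only the inner
    products with m_n and m_(n+1) to be computed: the former is settled by the
    choice of coefficient, the latter vanishes because (x - 1/2) m_(n+1)^2 is
    odd about 1/2. *)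

Require Import Defs.
From HB Require Import structures.
From mathcomp Require Import all_boot all_order all_algebra.
From mathcomp Require Import all_classical all_reals all_analysis.
From mathcomp Require Import measurable_realfun ring lra.
From mathcomp Require finmap.

Set Implicit Arguments.
Unset Strict Implicit.
Unset Printing Implicit Defensive.

Import Order.TTheory GRing.Theory Num.Theory.
Import numFieldNormedType.Exports.

Local Open Scope classical_set_scope.
Local Open Scope ring_scope.

Lemma size_sub_leq (A : nzRingType) (p q : {poly A}) n :
  (size p <= n.+1)%N -> (size q <= n.+1)%N -> p`_n = q`_n ->
  (size (p - q)%R <= n)%N.
Proof.
move=> sp sq pq; apply/leq_sizeP => j; rewrite leq_eqVlt coefB => /predU1P[<-|nj].
  by rewrite pq subrr.
by rewrite !nth_default ?subrr // (leq_trans _ nj).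
Qed.

(** * Monic orthogonal polynomials for a definite linear form *)

Section MonicOrthogonal.
Variables (F : numFieldType) (L : {scalar {poly F}}).
Variable m : nat -> {poly F}.
Hypothesis L_def : forall p : {poly F}, L (p * p) = 0 -> p = 0.
Hypothesis size_m : forall k, size (m k) = k.+1.
Hypothesis monic_m : forall k, m k \is monic.
Hypothesis orth_m : forall k l, k <> l -> L (m k * m l) = 0.

Let coef_m n : (m n)`_n = 1.
Proof. by have /monicP := monic_m n; rewrite lead_coefE size_m. Qed.

Lemma orthogonal_lower_degree n (p q : {poly F}) :
  (forall k, (k < n)%N -> L (p * m k) = 0) -> (size q <= n)%N -> L (p * q) = 0.
Proof.
elim: n q => [|n IHn] q pm sq.
  by move: sq; rewrite leqn0 size_poly_eq0 => /eqP ->; rewrite mulr0 linear0.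
have -> : q = (q - q`_n *: m n) + q`_n *: m n by rewrite subrK.
rewrite mulrDr -scalerAr linearD [L (_ *: _)]linearZ /= pm // mulr0 addr0.
apply: IHn => [k kn|]; first by apply: pm; exact: ltnW.
apply: size_sub_leq => //; last by rewrite coefZ coef_m mulr1.
by rewrite (leq_trans (size_scale_leq _ _)) ?size_m.
Qed.

Lemma orthogonal_m n (q : {poly F}) : (size q <= n)%N -> L (m n * q) = 0.
Proof.
by apply: orthogonal_lower_degree => k kn; apply: orth_m => nk; rewrite nk ltnn in kn.
Qed.

Lemma orthogonal_eq0 n (p : {poly F}) : (size p <= n)%N ->
  (forall k, (k < n)%N -> L (p * m k) = 0) -> p = 0.
Proof. by move=> sp pm; apply: L_def; exact: orthogonal_lower_degree pm sp. Qed.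

(** The difference [q - m n] loses its leading term, and [m n] is orthogonal to everything of lower
    degree. *)
Lemma mulm_monic n (q : {poly F}) :
  (size q <= n.+1)%N -> q`_n = 1 -> L (m n * q) = L (m n * m n).
Proof.
move=> sq qn; apply/eqP; rewrite -subr_eq0 -linearB -mulrBr; apply/eqP.
by apply: orthogonal_m; apply: size_sub_leq; rewrite ?size_m // qn coef_m.
Qed.

(** * Parity and recurrence under reflection invariance *)

Hypothesis L_refl : forall p : {poly F}, L (p \Po (1 - 'X)) = L p.

Let size_refl (p : {poly F}) : size (p \Po (1 - 'X)) = size p.
Proof.
by apply: size_comp_poly2; rewrite -opprB size_polyN -polyC1 size_XsubC.
Qed.

Let reflK (p : {poly F}) : (p \Po (1 - 'X)) \Po (1 - 'X) = p.
Proof.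
by rewrite -comp_polyA comp_polyB comp_polyX -polyC1 comp_polyC subKr comp_polyXr.
Qed.

Lemma monic_orthogonal_refl n : m n \Po (1 - 'X) = (-1) ^+ n *: m n.
Proof.
apply/eqP; rewrite -subr_eq0; apply/eqP.
have lcX : lead_coef (1 - 'X : {poly F}) = -1.
  by rewrite -opprB lead_coefN -polyC1 lead_coefXsubC.
have sX : size (1 - 'X : {poly F}) = 2.
  by rewrite -opprB size_polyN -polyC1 size_XsubC.
apply: (@orthogonal_eq0 n) => [|k kn].
  apply: size_sub_leq; rewrite ?size_refl ?size_m //.
    by rewrite (leq_trans (size_scale_leq _ _)) ?size_m.
  (* Substituting [1 - 'X], of leading coefficient [-1], multiplies the leading coefficient by
     [(-1) ^+ n], so the top terms cancel. *)
  have := @lead_coef_comp F (m n) (1 - 'X); rewrite sX => /(_ isT).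
  rewrite lcX (monicP (monic_m n)) lead_coefE size_refl size_m /= => ->.
  by rewrite coefZ coef_m mulr1 mul1r.
rewrite mulrBl linearB /= -scalerAl linearZ /= orthogonal_m ?size_m // mulr0 subr0.
(* The reflection is an involution preserved by [L], so it moves from [m n] to [m k], whose degree
   stays below [n]. *)
by rewrite -L_refl comp_polyM reflK orthogonal_m // size_refl size_m.
Qed.

Lemma monic_orthogonal0 : m 0%N = 1.
Proof. by rewrite [m 0]size1_polyC ?size_m // coef_m. Qed.

Lemma monic_orthogonal_parity n x : (m n).[1 - x] = (-1) ^+ n * (m n).[x].
Proof. by rewrite -hornerZ -monic_orthogonal_refl horner_comp !hornerE. Qed.

Lemma monic_orthogonal1 : m 1%N = 'X - (1 / 2)%:P.
Proof.
have m1E : m 1%N = 'X + ((m 1%N)`_0)%:P.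
  apply/polyP => -[|[|i]]; rewrite coefD coefX coefC /= ?add0r ?addr0 ?coef_m //.
  by rewrite nth_default // size_m.
(* Parity at [x = 0] says [1 + c = - c] for the constant coefficient [c]. *)
have := monic_orthogonal_parity 1 0; rewrite m1E !hornerE => h.
congr (_ + _); rewrite -polyCN; congr (_%:P); set c := _`_0 in h *.
apply/eqP; rewrite -subr_eq0.
have -> : c - - 2^-1 = (1 - 0 + c - (-1) ^+ 1 * c) / 2 by field.
by rewrite h subrr mul0r.
Qed.

Lemma monic_orthogonal_recurrence n :
  m n.+2 = ('X - (1 / 2)%:P) * m n.+1
           - (L (m n.+1 * m n.+1) / L (m n * m n)) *: m n.
Proof.
set c := 'X - _; set a := _ / _.
have sc k : size (c * m k) = k.+2.
  by rewrite size_monicM ?monicXsubC ?size_XsubC ?size_m // -size_poly_eq0 size_m.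
have cc k : (c * m k)`_k.+1 = 1.
  have : c * m k \is monic by rewrite monicMl ?monicXsubC.
  by move=> /monicP; rewrite lead_coefE sc.
have c_refl : c \Po (1 - 'X) = - c.
  rewrite /c comp_polyB comp_polyX comp_polyC opprB -polyC1.
  rewrite (_ : 1%:P = (1/2)%:P + (1/2)%:P :> {poly F}) -?polyCD.
    by rewrite polyCD; ring.
  by congr (_%:P); field.
(* From here on [c] enters only as a monic factor of degree 1 that is odd about 1/2. *)
clearbody c.
have nm0 k : L (m k * m k) != 0.
  by apply/eqP => /L_def /(congr1 (size \o polyseq))/=; rewrite size_m size_poly0.
apply/eqP; rewrite eq_sym -subr_eq0; apply/eqP.
apply: (@orthogonal_eq0 n.+2) => [|k].
  apply: size_sub_leq; rewrite ?size_m //.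
    rewrite (leq_trans (size_polyD _ _)) // geq_max sc leqnn /= size_polyN.
    by rewrite (leq_trans (size_scale_leq _ _)) // size_m ltnW.
  rewrite coefB cc coefZ coef_m nth_default ?mulr0 ?subr0 // size_m ltnW //.
move=> kn2.
(* Multiplication by [c] is self-adjoint: moving it onto [m k] reduces the claim to comparing the
   degree of [c * m k] with [n.+1]. *)
have -> : (c * m n.+1 - a *: m n - m n.+2) * m k =
          m n.+1 * (c * m k) - a *: (m n * m k) - m n.+2 * m k.
  by rewrite 2!mulrBl -scalerAl mulrAC (mulrC (c * _)).
rewrite 2!linearB [L (_ *: _)]linearZ /= (orthogonal_m (n := n.+2)) ?size_m // subr0.
move: kn2; rewrite ltnS leq_eqVlt => /predU1P[->|].
  (* Case [k = n.+1]: by reflection the remaining value equals its own negative. *)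
  rewrite orth_m ?mulr0 ?subr0; last by move=> h; have := n_Sn n.
  have L0 : L (m n.+1 * (c * m n.+1)) = - L (m n.+1 * (c * m n.+1)).
    rewrite -{1}L_refl !comp_polyM monic_orthogonal_refl c_refl.
    rewrite mulNr mulrN linearN -!scalerAr -scalerAl scalerA -exprMn.
    by rewrite mulrNN mulr1 expr1n scale1r.
  have : L (m n.+1 * (c * m n.+1)) *+ 2 == 0 by rewrite mulr2n {2}L0 subrr.
  by rewrite mulrn_eq0 => /eqP.
(* Case [k = n]: [c * m n] is monic of degree [n.+1], so its pairing with [m n.+1] is the numerator
   of [a]. For [k < n] its analogue [c * m k] has degree at most [n]. *)
rewrite ltnS leq_eqVlt => /predU1P[->|kn].
  by rewrite mulm_monic ?sc // /a divfK ?subrr.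
by rewrite !orthogonal_m ?sc ?size_m // mulr0 subrr.
Qed.

End MonicOrthogonal.

(** An infinite root set would contain [size p] distinct roots, more than the degree allows. *)
Lemma finite_root (F : idomainType) (p : {poly F}) :
  p != 0 -> finite_set [set x | root p x].
Proof.
move=> p0; apply: contrapT => /infinite_set_fset => /(_ (size p)) [A Ap szA].
have /negP := p0; apply; apply/eqP; apply: (@roots_geq_poly_eq0 _ p (finmap.enum_fset A)).
- by apply/allP => x xA; exact: Ap.
- exact: finmap.fset_uniq.
- exact: szA.
Qed.

(** * Integration against the measure as a definite, reflection-invariant form *)

Section PolynomialIntegral.
Variables (R : realType) (mu : borel_measure R).

Lemma integrable_horner (p : {poly R}) :
  mu.-integrable `[0, 1] (EFin \o (horner p : measurableTypeR R -> R)).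
Proof.
apply: measurable_bounded_integrable => //.
- by rewrite ltey_eq fin_num_measure.
- exact: measurable_poly.
(* Boundedness comes from continuity on a compact interval. *)
- have : compact (horner p @` `[(0 : R), 1]).
    apply: continuous_compact; last exact: segment_compact.
    by apply: continuous_subspaceT; exact: continuous_horner.
  move=> /compact_bounded [M [Mr HM]]; exists M; split => // x Mx y y01 /=.
  by apply: HM => //; exists y.
Qed.

(** This is the form that instantiates [L]; the inner product depends only on the product of its
    arguments, so a linear form in one polynomial suffices. *)
Definition poly_integral (p : {poly R}) : R := \int[mu]_(x in `[0, 1]) p.[x].

Lemma poly_integral_is_linear : linear_for *%R poly_integral.
Proof.
move=> a p q; rewrite /poly_integral.
rewrite -RintegralZl //; last exact: integrable_horner.
rewrite -RintegralD //; last exact: integrable_horner.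
- by apply: eq_Rintegral => x _; rewrite hornerD hornerZ.
- have -> : (fun x => a * p.[x]) = horner (a *: p).
    by apply/funext => x; rewrite hornerZ.
  exact: integrable_horner.
Qed.

HB.instance Definition _ :=
  GRing.isLinear.Build R {poly R} R *%R poly_integral poly_integral_is_linear.

Lemma inner_muE (p q : {poly R}) : inner_mu mu p q = poly_integral (p * q).
Proof. by apply: eq_Rintegral => x _; rewrite hornerM. Qed.

Lemma norm_mu_sqr (p : {poly R}) : norm_mu mu p ^+ 2 = poly_integral (p * p).
Proof.
rewrite /norm_mu sqr_sqrtr; last by apply: Rintegral_ge0 => x _; exact: exprn_ge0.
by apply: eq_Rintegral => x _; rewrite hornerM -expr2 real_normK // num_real.
Qed.

(** Symmetry says that [mu] equals its pushforward under the map [phi] sending [x] to [1 - x], so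
    this is a change of variables that preserves the interval. *)
Lemma poly_integral_refl (p : {poly R}) : symmetric_measure mu ->
  poly_integral (p \Po (1 - 'X)) = poly_integral p.
Proof.
move=> mu_sym; rewrite /poly_integral /Rintegral; congr fine.
pose phi (x : measurableTypeR R) : measurableTypeR R := 1 - x.
have mphi : measurable_fun setT phi.
  have -> : phi = horner (1 - 'X) by apply/funext => x; rewrite !hornerE.
  exact: measurable_poly.
have phi01 : phi @^-1` `[0, 1]%classic = `[0, 1]%classic.
  by apply/seteqP; split => x; rewrite /phi /= !in_itv /= => /andP[? ?];
    apply/andP; split; lra.
transitivity (\int[pushforward mu phi]_(x in `[0%R, 1%R]%classic) (p.[x])%:E)%E; last first.
  apply: eq_measure_integral => A mA _; rewrite /pushforward [RHS](mu_sym _ mA).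
  (* Symmetry is stated with images and the pushforward with preimages; they agree because [phi] is
     an involution. *)
  congr (mu _); apply/seteqP; split => [x Ax|_ [x Ax <-]].
    by exists (1 - x); rewrite /phi /= ?subKr.
  by rewrite /phi /= subKr.
rewrite integral_pushforward //.
- by rewrite phi01; apply: eq_integral => x _ /=; rewrite horner_comp !hornerE.
- by apply/measurable_EFinP; exact: measurable_poly.
- rewrite phi01; apply: eq_integrable (integrable_horner (p \Po (1 - 'X))) => //.
  by move=> x _ /=; rewrite horner_comp !hornerE.
Qed.

(** A nonnegative integrand with zero integral vanishes almost everywhere, so for nonzero [p] the
    measure would live on the finite root set of [p]. *)
Lemma poly_integral_sqr_eq0 (p : {poly R}) :
  supported_in01 mu -> infinitely_supported mu ->
  poly_integral (p * p) = 0 -> p = 0.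
Proof.
move=> mu01 mu_inf pp0; apply/eqP/negPn/negP => p0.
have int0 : (\int[mu]_(x in `[0%R, 1%R]%classic) `|((p * p).[x])%:E| = 0)%E.
  transitivity (poly_integral (p * p))%:E; last by rewrite pp0.
  rewrite /poly_integral /Rintegral fineK; last first.
    exact: integrable_fin_num (integrable_horner _).
  by apply: eq_integral => x _; rewrite gee0_abs // lee_fin hornerM -expr2 sqr_ge0.
have mpp : measurable_fun (`[0, 1]%classic : set (measurableTypeR R))
    (fun x : measurableTypeR R => ((p * p).[x])%:E).
  by apply/measurable_EFinP; exact: measurable_poly.
have [N [mN N0 subN]] :=
  (ae_eq_integral_abs mu (measurable_itv `[0, 1]) mpp).1 int0.
have rootsN : finite_set [set x | root p x].
  exact: finite_root.
have mroots : measurable (~` [set x | root p x] : set (measurableTypeR R)).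
  apply: measurableC; apply: countable_measurable; last exact: finite_set_countable.
  exact: measurable_set1.
have /negP := mu_inf _ rootsN; apply; apply/eqP/(negligibleP mu mroots).
(* A non-root lies outside the interval, which is null by the support condition, or in the null set
   [N] where [p * p] may be nonzero. *)
apply: (@negligibleS _ _ _ mu (~` `[0, 1] `|` N)).
  move=> x /= px; have [x01|x01] := pselect (`[0, 1]%classic x); last by left.
  right; apply: subN => /= /(_ x01) [] /eqP.
  by rewrite hornerM mulf_eq0 orbb => /px.
apply: negligibleU; last by exists N; split.
by apply/negligibleP => //; apply: measurableC; exact: measurable_itv.
Qed.

End PolynomialIntegral.

Theorem proposition2p11 (R : realType) (mu : borel_measure R)
  (mu01 : supported_in01 mu)
  (mu_sym : symmetric_measure mu)
  (mu_inf : infinitely_supported mu)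
  (m : nat -> {poly R})
  (m_leg : monic_legendre_sequence mu m) :
  [/\ m 0%N = 1,
      m 1%N = 'X - (1 / 2)%:P,
      (forall (n : nat) (x : R), (m n).[1 - x] = (-1) ^+ n * (m n).[x]) &
      (forall n : nat,
         m n.+2 = ('X - (1 / 2)%:P) * m n.+1
                  - (norm_mu mu (m n.+1) ^+ 2 / norm_mu mu (m n) ^+ 2) *: m n)].
Proof.
have [[size_m orth] monic_m] := m_leg.
have orth_m k l : k <> l -> poly_integral mu (m k * m l) = 0.
  by move=> /orth; rewrite inner_muE.
have L_def p := @poly_integral_sqr_eq0 R mu p mu01 mu_inf.
have L_refl p := @poly_integral_refl R mu p mu_sym.
split.
- exact: monic_orthogonal0.
- exact: (@monic_orthogonal1 R (poly_integral mu)).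
- exact: (@monic_orthogonal_parity R (poly_integral mu)).
- move=> n; rewrite !norm_mu_sqr.
  exact: (@monic_orthogonal_recurrence R (poly_integral mu)).
Qed.
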